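(* Let $m\ge 2$ be an integer and $n=2^m$. Then the line graph $L(\overline{\Gamma(\mathbb{Z}_n[i])})$ of the complement of the zero-divisor graph of $\mathbb{Z}_n[i]$ is pancyclic.
   Context: $\mathbb{Z}_n[i]=\mathbb{Z}[i]/\langle n\rangle=\{a+bi : a,b\in\mathbb{Z}_n\}$ with $i^2=-1$. For a finite commutative ring $R$ with unity, $\Gamma(R)$ has vertex set the nonzero zero-divisors of $R$, distinct $x,y$ adjacent iff $xy=0$. $\overline{G}$ is the complement graph of $G$. The line graph $L(G)$ has the edges of $G$ as vertices, two being adjacent iff they share an endpoint in $G$. A graph of order $N$ is pancyclic if $N\ge 3$ and it contains a cycle of length $k$ for every $3\le k\le N$. *)

(* Defs.v *)
From HB Require Import structures.
From mathcomp Require Import all_boot all_order all_fingroup all_algebra.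
From mathcomp Require Import ring.

Set Implicit Arguments.
Unset Strict Implicit.
Unset Printing Implicit Defensive.

Import GRing.Theory.
Local Open Scope ring_scope.

(** R[i] = {a + b i : a, b in R} with i^2 = -1; Z_n[i] is [gaussian 'Z_n]
    (for n > 1, since 'Z_0 and 'Z_1 both denote Z/2Z). *)
Record gaussian (R : Type) : Type := Gaussian { gre : R; gim : R }.

Section GaussianFinite.
Variable R : Type.

Definition pair_of_gaussian (z : gaussian R) : R * R := (gre z, gim z).
Definition gaussian_of_pair (p : R * R) : gaussian R := Gaussian p.1 p.2.

Lemma pair_of_gaussianK : cancel pair_of_gaussian gaussian_of_pair.
Proof. by case. Qed.

End GaussianFinite.

HB.instance Definition _ (R : eqType) :=
  Equality.copy (gaussian R) (can_type (@pair_of_gaussianK R)).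
HB.instance Definition _ (R : choiceType) :=
  Choice.copy (gaussian R) (can_type (@pair_of_gaussianK R)).
HB.instance Definition _ (R : countType) :=
  Countable.copy (gaussian R) (can_type (@pair_of_gaussianK R)).
HB.instance Definition _ (R : finType) :=
  Finite.copy (gaussian R) (can_type (@pair_of_gaussianK R)).

Section GaussianRing.
Variable R : comNzRingType.
Implicit Types x y z : gaussian R.

Definition gzero : gaussian R := Gaussian 0 0.
Definition gone : gaussian R := Gaussian 1 0.
Definition gadd x y : gaussian R := Gaussian (gre x + gre y) (gim x + gim y).
Definition gopp x : gaussian R := Gaussian (- gre x) (- gim x).
Definition gmul x y : gaussian R :=
  Gaussian (gre x * gre y - gim x * gim y) (gre x * gim y + gim x * gre y).

Lemma gaddA : associative gadd.
Proof. by move=> x y z; rewrite /gadd /= !addrA. Qed.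
Lemma gaddC : commutative gadd.
Proof. by move=> x y; congr Gaussian; apply: addrC. Qed.
Lemma gadd0 : left_id gzero gadd.
Proof. by case=> a b; rewrite /gadd /= !add0r. Qed.
Lemma gaddN : left_inverse gzero gopp gadd.
Proof. by move=> x; rewrite /gadd /= !addNr. Qed.

HB.instance Definition _ :=
  GRing.isZmodule.Build (gaussian R) gaddA gaddC gadd0 gaddN.

Lemma gmulA : associative gmul.
Proof. by move=> x y z; congr Gaussian => /=; ring. Qed.
Lemma gmulC : commutative gmul.
Proof. by move=> x y; congr Gaussian => /=; ring. Qed.
Lemma gmul1 : left_id gone gmul.
Proof. by case=> a b; congr Gaussian => /=; ring. Qed.
Lemma gmulDl : left_distributive gmul gadd.
Proof. by move=> x y z; congr Gaussian => /=; ring. Qed.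
Lemma gone_neq0 : gone != 0.
Proof. by apply/eqP => -[] /eqP; rewrite oner_eq0. Qed.

HB.instance Definition _ :=
  GRing.Zmodule_isComNzRing.Build (gaussian R)
    gmulA gmulC gmul1 gmulDl gone_neq0.

Lemma gaussian_i2 : Gaussian 0 1 * Gaussian 0 1 = -1 :> gaussian R.
Proof. by congr Gaussian => /=; ring. Qed.

End GaussianRing.

(** Lets the canonical [finComNzRingType] structure be inferred. *)
HB.instance Definition _ (R : finComNzRingType) := Finite.on (gaussian R).

Record sgraph := SGraph {
  vertex :> finType;
  adj : rel vertex;
  adj_sym : symmetric adj;
  adj_irr : irreflexive adj
}.

Section ZeroDivisorGraph.
Variable R : finComNzRingType.

Definition zero_divisor (x : R) : bool := [exists y, (y != 0) && (x * y == 0)].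

Definition zdg_vertex : finType := {x : R | (x != 0) && zero_divisor x}.

Definition zdg_adj : rel zdg_vertex :=
  fun x y => (x != y) && (val x * val y == 0).

Lemma zdg_adj_sym : symmetric zdg_adj.
Proof. by move=> x y; rewrite /zdg_adj eq_sym mulrC. Qed.
Lemma zdg_adj_irr : irreflexive zdg_adj.
Proof. by move=> x; rewrite /zdg_adj eqxx. Qed.

Definition zero_divisor_graph : sgraph := SGraph zdg_adj_sym zdg_adj_irr.

End ZeroDivisorGraph.

Section GraphOperations.
Variable G : sgraph.

Definition compl_adj : rel G := fun x y => (x != y) && ~~ adj x y.

Lemma compl_adj_sym : symmetric compl_adj.
Proof. by move=> x y; rewrite /compl_adj eq_sym adj_sym. Qed.
Lemma compl_adj_irr : irreflexive compl_adj.
Proof. by move=> x; rewrite /compl_adj eqxx. Qed.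

Definition complement_graph : sgraph := SGraph compl_adj_sym compl_adj_irr.

Definition is_edge (e : {set G}) : bool :=
  [exists x, exists y, adj x y && (e == [set x; y])].

Definition edge : finType := {e : {set G} | is_edge e}.

Definition line_adj : rel edge :=
  fun e f => (e != f) && (val e :&: val f != set0).

Lemma line_adj_sym : symmetric line_adj.
Proof. by move=> e f; rewrite /line_adj eq_sym setIC. Qed.
Lemma line_adj_irr : irreflexive line_adj.
Proof. by move=> e; rewrite /line_adj eqxx. Qed.

Definition line_graph : sgraph := SGraph line_adj_sym line_adj_irr.

(** [ucycle (@adj G) c] alone also accepts sequences of fewer than three
    vertices (a single edge traversed both ways, or the empty sequence);
    it is a genuine cycle of length [k] of a simple graph when [k >= 3]. *)
Definition has_cycle_of_length (k : nat) : Prop :=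
  exists c : seq G, [/\ (3 <= k)%N, size c = k & ucycle (@adj G) c].

Definition pancyclic : Prop :=
  (3 <= #|G|)%N /\
  forall k : nat, (3 <= k <= #|G|)%N -> has_cycle_of_length k.

End GraphOperations.

(* Main.v *)
(** The zero divisors of Z_(2^m)[i] are the a + bi with a and b of the same
    parity.  In the complement of the zero-divisor graph, 2^(m-1) (1 + i) is
    isolated, because it annihilates the maximal ideal (1 + i); when a and b are
    odd, a + bi annihilates no other nonzero element, since its norm is twice a
    unit, so it is adjacent to every other non-isolated vertex.  Adding 1 + i
    maps the even vertices injectively to the odd ones, hence alternating between
    the two classes yields a cycle C through all non-isolated vertices.  In the
    line graph, the edges at one odd vertex form a clique of size |C| - 1, which
    gives the cycles of length less than |C|.  Following C while inserting any
    set of chords, each at one of its endpoints, gives all longer cycles. *)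
Require Import Defs.
From mathcomp Require Import all_boot all_algebra.
From mathcomp Require Import ring.

Set Implicit Arguments.
Unset Strict Implicit.
Unset Printing Implicit Defensive.

Import GRing.Theory.

(** * Rearrangements and alternations of sequences *)

Section SeqFacts.
Variable T : eqType.

(** Lets cycles be built with relations that hold on the diagonal, such as [meets], with
    distinctness recovered afterwards. *)
Lemma path_uniq_neq (r : rel T) x s :
  uniq (x :: s) -> path r x s -> path (fun y z => (y != z) && r y z) x s.
Proof.
elim: s x => //= y s IHs x /andP[] /[!inE] /norP[-> _] us /andP[-> ps].
exact: IHs.
Qed.

Lemma perm_flatten_fibers (U : eqType) (h : T -> U) (D : seq T) (c : seq U) :
  uniq c ->
  perm_eq (flatten [seq [seq e <- D | h e == v] | v <- c])
          [seq e <- D | h e \in c].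
Proof.
elim: c => [_|v c IHc /= /andP[vNc uc]]; first by rewrite filter_pred0.
have /(perm_cat (perm_refl [seq e <- D | h e == v])) := IHc uc.
move=> /perm_trans->//; rewrite perm_sym.
rewrite -(perm_filterC [pred e | h e == v]) -!filter_predI; apply: perm_cat;
  apply/permP => a; congr count; apply: eq_filter => e /=; rewrite inE.
  by case: eqP.
by case: eqP => // ->; rewrite (negPf vNc).
Qed.

(** Splits an unrolled walk into inserted items and steps. The final [y] contributes no [B y], so on
    a closed walk each vertex is served once. *)
Lemma perm_flatten_pairmap (U : eqType) (B : U -> seq T) (f : U -> U -> T) x p y :
  perm_eq (flatten (pairmap (fun v w => rcons (B v) (f v w)) x (rcons p y)))
          (flatten (map B (x :: p)) ++ pairmap f x (rcons p y)).
Proof.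
elim: p x => [|z p IHp] x /=; first by rewrite !cats0 cats1.
rewrite cat_rcons -catA perm_cat2l perm_sym -[f x z :: pairmap _ _ _]cat1s.
by rewrite perm_catCA /= perm_cons perm_sym; apply: IHp.
Qed.

Fixpoint interleave (s t : seq T) : seq T :=
  if s is b :: s' then
    if t is a :: t' then b :: a :: interleave s' t' else s
  else t.

Lemma perm_interleave s t : perm_eq (interleave s t) (s ++ t).
Proof.
elim: s t => [|b s IHs] [|a t] //=; first by rewrite cats0.
by rewrite perm_cons (perm_trans _ (_ : perm_eq (a :: (s ++ t)) _)) ?perm_cons //
  -cat1s perm_catCA.
Qed.

(** The size bound keeps any two entries of [s] from being consecutive, so every step has an end in
    [A]. *)
Lemma path_interleave (A : pred T) (r : rel T) a s t :
  (forall x y, A x || A y -> r x y) -> A a -> all A t -> size s <= (size t).+1 ->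
  path r a (interleave s t).
Proof.
move=> rA; elim: s a t => [|b s IHs] a [|a' t] //= Aa.
- move=> /andP[Aa' At] _; rewrite rA ?Aa //=.
  by elim: t a' Aa' At => //= z t IHt a' Aa' /andP[Az At]; rewrite rA ?Aa' ?IHt.
- by case: s {IHs} => // _ _; rewrite rA ?Aa.
- by move=> /andP[Aa' At] les; rewrite !rA ?Aa ?Aa' ?orbT ?IHs.
Qed.

End SeqFacts.

(** * Cycles in line graphs *)

Section LineGraph.
Variable G : sgraph.
Implicit Types (x y : G) (e f : edge G).

Lemma is_edge_adj x y : adj x y -> is_edge [set x; y].
Proof. by move=> xy; apply/existsP; exists x; apply/existsP; exists y; rewrite xy /=. Qed.

Definition meets : rel (edge G) := fun e f => val e :&: val f != set0.

Lemma meets_at x e f : x \in val e -> x \in val f -> meets e f.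
Proof. by move=> xe xf; apply/set0Pn; exists x; rewrite inE xe. Qed.

Lemma path_meets_star x e s :
  x \in val e -> {in s, forall f, x \in val f} -> path meets e s.
Proof.
elim: s e => //= f s IHs e xe sP.
have xf : x \in val f by apply: sP; rewrite mem_head.
by rewrite (meets_at xe xf) IHs // => g gs; apply: sP; rewrite inE gs orbT.
Qed.

(* Junk value [e0] when [x] and [y] are not adjacent. *)
Definition edge_of (e0 : edge G) x y : edge G := insubd e0 [set x; y].

Lemma val_edge_of e0 x y : adj x y -> val (edge_of e0 x y) = [set x; y].
Proof. by move=> xy; rewrite val_insubd is_edge_adj. Qed.

(* A walk in [G], each vertex [v] of which carries a list [B v] of edges at [v],
   unrolls to a walk in the line graph. *)
Lemma path_meets_walk (B : G -> seq (edge G)) e0 e x p :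
  (forall v f, f \in B v -> v \in val f) ->
  x \in val e -> path (@adj G) x p ->
  path meets e
    (flatten (pairmap (fun v w => rcons (B v) (edge_of e0 v w)) x p)).
Proof.
move=> BP; elim: p x e => [|y p IHp] x e xe //= /andP[xy yp].
have pB : path meets e (rcons (B x) (edge_of e0 x y)).
  apply: path_meets_star xe _ => f; rewrite mem_rcons inE => /orP[/eqP->|/BP//].
  by rewrite val_edge_of // !inE eqxx.
have ye : y \in val (edge_of e0 x y) by rewrite val_edge_of // !inE eqxx orbT.
by rewrite cat_path pB last_rcons (IHp y _ ye yp).
Qed.

Lemma pairmap_edge_sub e0 x p e : path (@adj G) x p ->
  e \in pairmap (edge_of e0) x p -> {subset val e <= x :: p}.
Proof.
elim: p x => //= y p IHp x /andP[xy yp]; rewrite inE => /orP[/eqP->|ep] v.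
  by rewrite val_edge_of // !inE => /orP[] ->; rewrite ?orbT.
by move=> /(IHp _ yp ep); rewrite [in X in _ -> X]inE => ->; rewrite orbT.
Qed.

Lemma uniq_pairmap_edge e0 x p : uniq (x :: p) -> path (@adj G) x p ->
  uniq (pairmap (edge_of e0) x p).
Proof.
elim: p x => //= y p IHp x /andP[xNp up] /andP[xy yp].
rewrite IHp // andbT; apply: contra xNp => /(pairmap_edge_sub yp); apply.
by rewrite val_edge_of // !inE eqxx.
Qed.

Lemma uniq_cycle_edges e0 x p : uniq (x :: p) -> 1 < size p ->
  cycle (@adj G) (x :: p) -> uniq (pairmap (edge_of e0) x (rcons p x)).
Proof.
case: p => // y p; rewrite [size _]/= ltnS [cycle _ _]/= rcons_path => ux p0.
move=> /andP[xy /andP[yp lx]].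
rewrite -cats1 [cat _ _]/= [pairmap _ _ _]/= pairmap_cat /= cats1.
rewrite mem_rcons inE negb_or rcons_uniq.
have uy : uniq (y :: p) by case/andP: ux.
have xN : x \notin y :: p by case/andP: ux.
have xnot e : x \in val e -> e \notin pairmap (edge_of e0) y p.
  by move=> xe; apply: contra xN => /(pairmap_edge_sub yp); apply.
rewrite !xnot ?uniq_pairmap_edge // ?val_edge_of // ?inE ?eqxx ?orbT // !andbT.
(* The closing edge contains [last y p], which differs from [x] and [y] since [p] is nonempty; hence
   it is not the first edge. *)
apply/eqP => /(congr1 val); rewrite !val_edge_of // => /setP/(_ (last y p)).
rewrite !inE eqxx orTb.
have: last y p \in p by case: p p0 {ux yp lx uy xN xnot} => //= z p _; apply: mem_last.
move: uy xN => /= /andP[yN _] /[!inE] /norP[_ xNp] lp.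
by case: eqP => [E|_]; [rewrite -E lp in xNp | case: eqP => // E; rewrite -E lp in yN].
Qed.

Lemma cycle_line_adj (c : seq (edge G)) :
  1 < size c -> uniq c -> cycle meets c -> ucycle (@line_adj G) c.
Proof.
case: c => // e c; rewrite [size _]/= ltnS => c0 ue ce.
apply/andP; split; last exact: ue.
move: ce; rewrite /= !rcons_path => /andP[ec le].
have -> := path_uniq_neq ue ec; rewrite /=.
apply/andP; split; last exact: le.
case/andP: ue => + _; apply: contra => /eqP <-.
by case: c c0 {ec le} => //= f c _; apply: mem_last.
Qed.

(* Long cycles follow the given cycle, with chords inserted at one of their
   endpoints; short ones live in the clique of the edges at [x]. *)
Lemma line_graph_pancyclic x p :
  1 < size p -> uniq (x :: p) -> cycle (@adj G) (x :: p) ->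
  {in p, forall y, adj x y} ->
  (forall y z, adj y z -> y \in x :: p \/ z \in x :: p) ->
  pancyclic (line_graph G).
Proof.
move=> p1 ux cx hub dom.
have [e0] : inhabited (edge G).
  case: p p1 hub {ux cx dom} => // y p _ /(_ y (mem_head _ _)) xy.
  by split; exact: (Sub [set x; y] (is_edge_adj xy)).
have uC := uniq_cycle_edges e0 ux p1 cx.
set C := pairmap _ _ _ in uC.
have sC : size C = (size p).+1 by rewrite size_pairmap size_rcons.
have leC : size C <= #|line_graph G| by rewrite -(card_uniqP uC) max_card.
split=> [|k /andP[k3 kE]]; first by apply: leq_trans leC; rewrite sC.
(* The star at [x] has [size p] edges to [p]; from [k = (size p).+1] on, the full cycle [C] is
   available, at first with no chord. *)
have [kp|kp] := leqP k (size p).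
  pose c := take k [seq edge_of e0 x y | y <- p].
  have sc : size c = k by rewrite size_takel ?size_map.
  exists c; split=> //; apply: cycle_line_adj; first by rewrite sc ltnW.
    apply: take_uniq; rewrite map_inj_in_uniq; first by case/andP: ux.
    move=> y z yp zp /(congr1 val); rewrite !val_edge_of ?hub // => /setP/(_ y).
    rewrite !inE eqxx orbT; case: (y =P x) => [E|_ /esym/eqP] //.
    by move: ux; rewrite /= -E yp.
  have: {in c, forall e : edge G, x \in val e}.
    by move=> e /mem_take/mapP[y yp ->]; rewrite val_edge_of ?hub // !inE eqxx.
  case: c {sc} => //= e c cP.
  apply: (@path_meets_star x); first by apply: cP; rewrite mem_head.
  by move=> f; rewrite mem_rcons; apply: cP.
pose D := take (k - size C) [seq e <- enum {: edge G} | e \notin C].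
have sD : size D = k - size C.
  rewrite size_takel // leq_subLR.
  have /perm_size -> : perm_eq [seq e <- enum {: edge G} | e \notin C] (enum [predC C]).
    apply: uniq_perm; rewrite ?enum_uniq ?(filter_uniq _ (enum_uniq _)) // => e.
    by rewrite mem_filter !mem_enum andbT.
  by rewrite -(card_uniqP uC) -cardE cardC.
(* Selects the endpoint at which a chord is inserted; by [dom] one lies on the cycle, so the default
   [x] is never reached. *)
pose h (e : edge G) := odflt x [pick v in val e | v \in x :: p].
have hP e : (h e \in val e) && (h e \in x :: p).
  rewrite /h; case: pickP => [v //|none].
  have /existsP[y /existsP[z /andP[yz /eqP ez]]] := valP e.
  case: (dom _ _ yz) => [yp|zp].
    by have := none y; rewrite ez yp !inE eqxx.
  by have := none z; rewrite ez zp !inE eqxx orbT.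
pose B v := [seq e <- D | h e == v].
have BP v f : f \in B v -> v \in val f.
  by rewrite mem_filter => /andP[/eqP<- _]; case/andP: (hP f).
pose c := flatten (pairmap (fun v w => rcons (B v) (edge_of e0 v w)) x (rcons p x)).
have cD : perm_eq c (D ++ C).
  apply: perm_trans (perm_flatten_pairmap _ _ _ _ _) _; rewrite perm_cat2r.
  apply: perm_trans (perm_flatten_fibers _ _ ux) _.
  rewrite (@eq_in_filter _ _ predT) ?filter_predT // => e _.
  by case/andP: (hP e).
have sc : size c = k by rewrite (perm_size cD) size_cat sD subnK // sC.
exists c; split=> //; apply: cycle_line_adj; first by rewrite sc ltnW.
  rewrite (perm_uniq cD) cat_uniq uC andbT take_uniq ?(filter_uniq _ (enum_uniq _)) //=.
  by apply/hasPn => e eC; apply/negP => /mem_take; rewrite mem_filter eC.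
(* The starting edge is also the last entry of [c], so this path closes up into a cycle. *)
have pc : path meets (edge_of e0 (last x p) x) c.
  apply: path_meets_walk => //; move: cx; rewrite /= rcons_path => /andP[_ lx].
  by rewrite val_edge_of // !inE eqxx orbT.
suff E : last (edge_of e0 (last x p) x) c = edge_of e0 (last x p) x.
  case: c pc E {sc cD} => //= f c /andP[ef fc] E.
  by rewrite rcons_path fc E.
by rewrite /c -cats1 pairmap_cat flatten_cat /= cats0 last_cat last_rcons.
Qed.

(* At least half of the non-isolated vertices are universal among them, so
   alternating gives a Hamiltonian cycle on the non-isolated part. *)
Lemma line_graph_pancyclic_universal (A B : {set G}) :
  #|B| <= #|A| -> 2 < #|A| -> [disjoint A & B] ->
  {in A & A :|: B, forall x y, x != y -> adj x y} ->
  (forall x y, adj x y -> x \in A :|: B) ->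
  pancyclic (line_graph G).
Proof.
move=> leBA A2 dAB univ dom.
case EA: (enum A) => [|a t]; first by rewrite cardE EA in A2.
have memA y : (y \in A) = (y \in a :: t) by rewrite -EA mem_enum.
pose p := interleave (enum B) t.
have pP : perm_eq (a :: p) (enum A ++ enum B).
  by rewrite EA /= perm_cons perm_sym perm_catC perm_sym perm_interleave.
have ap y : (y \in a :: p) = (y \in A :|: B).
  by rewrite (perm_mem pP) mem_cat !mem_enum inE.
have uap : uniq (a :: p).
  rewrite (perm_uniq pP) cat_uniq !enum_uniq andbT /=.
  apply/hasPn => y; rewrite !mem_enum => yB.
  by apply/negP => yA; move/pred0P: dAB => /(_ y); rewrite /= yA yB.
have aA : a \in A by rewrite memA mem_head.
have hub : {in p, forall y, adj a y}.
  move=> y yp; apply: univ; rewrite -?ap ?inE ?yp ?orbT //.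
  by apply: contraTneq yp => <-; case/andP: uap.
have sp : 1 < size p.
  by have := perm_size pP; rewrite size_cat -!cardE /= -ltnS => ->; rewrite ltn_addr.
apply: (@line_graph_pancyclic a p) => //; last first.
  by move=> y z /dom yAB; left; rewrite ap.
pose r : rel G := fun x y => (x \in A) || (y \in A).
have /(path_uniq_neq uap) pr : path r a p.
  apply: (@path_interleave _ [in A]) => //=.
    by apply/allP => y yt; rewrite memA inE yt orbT.
  by rewrite -cardE (leq_trans leBA) // cardE EA.
have lp : last a p \in p by case: p sp {pP ap uap hub pr} => //= y p _; apply: mem_last.
rewrite /= rcons_path adj_sym hub // andbT.
apply: (sub_in_path (P := [in A :|: B])) pr; last first.
  by apply/allP => y; rewrite ap.
move=> y z yAB zAB /andP[yz /orP[yA|zA]]; first exact: univ.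
by rewrite adj_sym univ // eq_sym.
Qed.

End LineGraph.

(** * Parity and annihilators in the Gaussian integers modulo a power of two *)

(** Multiply [x * y = 0] by the conjugate of [x]. *)
Lemma gaussian_mul_eq0 (R : comNzRingType) (x y : gaussian R) : (x * y = 0 ->
  (gre x ^+ 2 + gim x ^+ 2) * gre y = 0 /\ (gre x ^+ 2 + gim x ^+ 2) * gim y = 0)%R.
Proof.
case: x y => a b [u v] xy0.
have e1 : (a * u - b * v = 0)%R := congr1 (@gre _) xy0.
have e2 : (a * v + b * u = 0)%R := congr1 (@gim _) xy0.
split=> /=.
  transitivity (a * (a * u - b * v) + b * (a * v + b * u))%R; first by ring.
  by rewrite e1 e2 !mulr0 addr0.
transitivity (a * (a * v + b * u) - b * (a * u - b * v))%R; first by ring.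
by rewrite e1 e2 !mulr0 subr0.
Qed.

Section GaussianTwoPower.
Variable d : nat.
Hypothesis d_gt0 : 0 < d.
Local Notation n := (2 ^ d.+1).
Implicit Types a b : 'Z_n.

Let n_gt1 : 1 < n. Proof. by rewrite -{1}(expn0 2) ltn_exp2l. Qed.
Let n_even : odd (Zp_trunc n).+2 = false.
Proof. by rewrite Zp_cast // oddX. Qed.

Local Open Scope ring_scope.

Lemma odd_ZpD a b : odd (a + b)%R = odd a (+) odd b.
Proof. by rewrite -oddD -[RHS](odd_mod _ n_even). Qed.

Lemma odd_ZpM a b : odd (a * b)%R = odd a && odd b.
Proof. by rewrite -oddM -[RHS](odd_mod _ n_even). Qed.

Lemma odd_ZpN a : odd (- a)%R = odd a.
Proof.
by have := odd_ZpD a (- a); rewrite subrr; case: (odd a); case: (odd (- a)%R).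
Qed.

Lemma odd_Zp_nat k : odd (k%:R : 'Z_n)%R = odd k.
Proof. by rewrite val_Zp_nat // odd_mod // oddX. Qed.

Lemma odd_Zp_unit a : odd a -> a \is a GRing.unit.
Proof.
by move=> oa; rewrite -[a]natr_Zp unitZpE // coprimeXl // coprime2n.
Qed.

Lemma Zp_double_half a : a = 2%:R * (a./2)%:R + (odd a)%:R.
Proof.
by rewrite -natrM -natrD mul2n addnC odd_double_half natr_Zp.
Qed.

Definition half_period : 'Z_n := (2 ^ d)%:R.

Lemma half_period_neq0 : half_period != 0.
Proof.
apply/eqP => /(congr1 val) /=; rewrite val_Zp_nat // modn_small ?ltn_exp2l //.
by move/eqP; rewrite expn_eq0.
Qed.

Lemma odd_half_period : odd half_period = false.
Proof. by rewrite odd_Zp_nat oddX; case: d d_gt0. Qed.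

Lemma half_period_mul2 : half_period * 2%:R = 0.
Proof. by rewrite -natrM -expnSr pchar_Zp. Qed.

Lemma half_period_mul a : half_period * a = half_period *+ odd a.
Proof.
rewrite {1}[a]Zp_double_half mulrDr mulrA half_period_mul2 mul0r add0r.
by rewrite mulr_natr.
Qed.

(** The representative of [a] is a multiple of [2 ^ d] below [2 ^ d.+1], so its quotient is 0 or
    1. *)
Lemma mul2_Zp_eq0 a : 2%:R * a = 0 -> a = half_period *+ (a != 0).
Proof.
rewrite -{1}[a]natr_Zp -natrM => /(congr1 val)/eqP.
rewrite /= val_Zp_nat // -/(dvdn _ _) => dvd.
have /dvdnP[q aq] : (2 ^ d %| a)%N by rewrite -(@dvdn_pmul2l 2) // -expnS.
have an : (a < n)%N by rewrite -[X in (_ < X)%N](Zp_cast n_gt1).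
have q2 : (q < 2)%N by move: an; rewrite aq expnS ltn_pmul2r // expn_gt0.
case: (eqVneq a 0) => [->|a0] //=.
rewrite -[LHS]natr_Zp aq.
case: q q2 aq => [|[|//]] _ aq; last by rewrite mul1n.
by case/eqP: a0; apply: val_inj; rewrite /= aq.
Qed.

Lemma odd_norm_unit a b : odd a != odd b -> a ^+ 2 + b ^+ 2 \is a GRing.unit.
Proof.
move=> ab; apply: odd_Zp_unit; rewrite odd_ZpD !expr2 !odd_ZpM !andbb.
by case: (odd a) (odd b) ab => [] [].
Qed.

(** Odd squares are 1 modulo 4, so the norm is 2 modulo 4. *)
Lemma even_norm a b : odd a -> odd b ->
  exists2 u : 'Z_n, u \is a GRing.unit & a ^+ 2 + b ^+ 2 = 2%:R * u.
Proof.
move=> oa ob; rewrite [a]Zp_double_half [b]Zp_double_half oa ob -[nat_of_bool true]/1%N.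
set k := (a./2)%:R; set l := (b./2)%:R.
exists (1 + 2%:R * (k ^+ 2 + k + l ^+ 2 + l)); last by ring.
apply: odd_Zp_unit; rewrite odd_ZpD odd_ZpM odd_Zp_nat addbF.
exact: (odd_Zp_nat 1).
Qed.

Local Notation Zi := (gaussian 'Z_n).
Implicit Types x y : Zi.

(* Generates the socle: the annihilator of the maximal ideal [(1 + i)]. *)
Definition socle : Zi := Gaussian half_period half_period.

Lemma socle_neq0 : socle != 0.
Proof. by apply: contra half_period_neq0 => /eqP[->]. Qed.

(** With unequal parities the norm is a unit, which forces any annihilated [y] to vanish. *)
Lemma zero_divisor_parity x : zero_divisor x -> odd (gre x) = odd (gim x).
Proof.
case/existsP=> y /andP[y0 /eqP/gaussian_mul_eq0[e1 e2]].
apply/eqP; apply: contraNT y0 => /odd_norm_unit U.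
case: y e1 e2 => u v /= e1 e2; apply/eqP; congr Gaussian; apply: (mulrI U);
  by rewrite mulr0.
Qed.

Lemma socle_mul x : odd (gre x) = odd (gim x) -> x * socle = 0.
Proof.
move=> E; rewrite [LHS]/(gmul _ _) /gmul /= ![_ * half_period]mulrC !half_period_mul E.
rewrite subrr -mulrnDr addnn -muln2 mulnC mulrnA -[_ *+ 2]mulr_natr half_period_mul2.
by rewrite mul0rn.
Qed.

Lemma parity_zero_divisor x : odd (gre x) = odd (gim x) -> zero_divisor x.
Proof.
by move=> E; apply/existsP; exists socle; rewrite socle_neq0 socle_mul /=.
Qed.

Lemma odd_odd_annihilator x y : odd (gre x) -> odd (gim x) ->
  x * y = 0 -> y != 0 -> y = socle.
Proof.
move=> oa ob xy0 y0; have [e1 e2] := gaussian_mul_eq0 xy0.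
have [u U E] := even_norm oa ob.
have canc c : (gre x ^+ 2 + gim x ^+ 2) * c = 0 -> 2%:R * c = 0.
  by rewrite E -mulrA mulrCA => h; apply: (mulrI U); rewrite mulr0.
move/(congr1 (@gre _)): xy0; move: y0 (mul2_Zp_eq0 (canc _ e1)) (mul2_Zp_eq0 (canc _ e2)).
case: y {e1 e2} => c c' /= + Ec Ec' +; rewrite Ec Ec'.
have p (c1 : 'Z_n) (b : bool) : odd c1 -> c1 * (half_period *+ b) = half_period *+ b.
  by move=> o1; rewrite mulrnAr mulrC half_period_mul o1.
(* Both coordinates of [y] are 0 or [half_period], which odd factors fix; the real part of
   [x * y = 0] then makes them equal. *)
by rewrite !p // => + /subr0_eq ccE; rewrite ccE; case: (c' != 0).
Qed.

End GaussianTwoPower.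

(** * Parity classes of the vertices *)

Theorem theorem5p1 (m n : nat) (hm : 2 <= m) (hn : n = 2 ^ m) :
  pancyclic (line_graph (complement_graph (zero_divisor_graph (gaussian 'Z_n)))).
Proof.
case: m hm hn => // d; rewrite ltnS => d0 ->.
set G := complement_graph _.
pose V := zdg_vertex (gaussian 'Z_(2 ^ d.+1)).
pose oddv := [pred x : V | odd (gre (val x))].
have par (x : V) : odd (gre (val x)) = odd (gim (val x)).
  by apply: zero_divisor_parity => //; case/andP: (valP x).
have nz (x : V) : val x != 0%R by case/andP: (valP x).
pose A : {set V} := [set x | oddv x].
pose B : {set V} := [set x | ~~ oddv x & val x != socle d].
have vtx (z : gaussian 'Z_(2 ^ d.+1)) : odd (gre z) -> odd (gim z) ->
    (z != 0%R) && zero_divisor z.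
  move=> oa ob; rewrite parity_zero_divisor ?oa ?ob // andbT.
  by apply: contraL oa => /eqP->.
have o1 : odd (1%R : 'Z_(2 ^ d.+1)) by rewrite -[1%R]/(1%:R)%R odd_Zp_nat.
have oN1 : odd (-1 : 'Z_(2 ^ d.+1))%R by rewrite odd_ZpN.
(* Three odd vertices, distinct because 1 and -1 differ modulo [n >= 4]; they give [2 < #|A|]. *)
pose v1 : V := exist _ (Gaussian 1 1)%R (vtx (Gaussian 1 1)%R o1 o1).
pose v2 : V := exist _ (Gaussian 1 (-1))%R (vtx (Gaussian 1 (-1))%R o1 oN1).
pose v3 : V := exist _ (Gaussian (-1) 1)%R (vtx (Gaussian (-1) 1)%R oN1 o1).
have n11 : (1 != -1 :> 'Z_(2 ^ d.+1))%R.
  rewrite -subr_eq0 opprK -[(1 + 1)%R]/(2%:R)%R; apply/eqP => /(congr1 (@nat_of_ord _)).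
  have n4 : 2 < 2 ^ d.+1 by rewrite -{1}(expn1 2) ltn_exp2l.
  by rewrite val_Zp_nat ?(ltnW n4) // modn_small.
have leBA : #|B| <= #|A|.
  (* On [B] the sum has odd coordinates and is a vertex, so the default [v1] does not occur
     there. *)
  pose f (x : V) : V := insubd v1 (val x + Gaussian 1 1)%R.
  have fE x : x \in B -> val (f x) = (val x + Gaussian 1 1)%R.
    rewrite !inE => /andP[ox _]; rewrite val_insubd vtx //.
      by rewrite odd_ZpD o1 (negPf ox).
    by rewrite odd_ZpD o1 -par (negPf ox).
  rewrite -(@card_in_imset _ _ f B); last first.
    move=> x y xB yB fxy; apply: (@val_inj _ _ V).
    by apply: (@addIr _ (Gaussian 1 1)%R); rewrite -(fE x xB) -(fE y yB) fxy.
  apply/subset_leq_card/subsetP => _ /imsetP[x xB ->].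
  by rewrite !inE (fE x xB) odd_ZpD o1; move: xB; rewrite !inE => /andP[/negPf ->].
have A_gt2 : 2 < #|A|.
  have u3 : uniq [:: v1; v2; v3].
    rewrite /= !inE andbT negb_or -!andbA; apply/and3P.
    split; apply: contra n11 => /eqP/(congr1 val) /= E; apply/eqP.
    - exact: (congr1 (@gim _) E).
    - exact: (congr1 (@gre _) E).
    - exact: (congr1 (@gre _) E).
  rewrite cardE; apply: (uniq_leq_size u3) => x.
  rewrite mem_enum [x \in A]inE !in_cons in_nil orbF.
  by case/or3P=> /eqP ->; [exact: o1 | exact: o1 | exact: oN1].
apply: (@line_graph_pancyclic_universal G A B leBA A_gt2).
- by apply/pred0P => x; rewrite /= !inE; case: (odd _).
- move=> x y; rewrite inE => xA yAB xy; rewrite /adj /= /compl_adj xy /= /zdg_adj xy /=.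
  apply/negP => /eqP xy0.
  (* The socle generator is excluded from [B], and from [A] because [half_period] is even when
     [0 < d]. *)
  have ys : val y = socle d.
    by apply: (odd_odd_annihilator xA _ xy0 (nz y)); rewrite -par.
  by move: yAB; rewrite !inE ys eqxx andbF orbF /= (odd_half_period d0).
- move=> x y; rewrite /= /compl_adj /= /zdg_adj => /andP[xy]; rewrite xy /= => xy0.
  rewrite !inE; case: (boolP (odd _)) => //= _; apply: contra xy0 => /eqP ->.
  by rewrite mulrC socle_mul // par.
Qed.
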